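(* Let $H$ be a dephased, symmetric complex Hadamard matrix of order $6$ all of whose diagonal entries are real. Then $H$ is equivalent to $S_6$ or to $D_6$.
   Context: A complex Hadamard matrix of order $n$ is an $n\times n$ complex matrix $H$ all of whose entries have modulus $1$ and whose rows are mutually orthogonal, i.e. $HH^*=nI$. It is dephased if all entries of its first row and first column equal $1$. It is symmetric if $H=H^T$. Two complex Hadamard matrices $H_1,H_2$ are equivalent, $H_1\cong H_2$, if $H_1=D_1P_1H_2P_2D_2$ for some unitary diagonal matrices $D_1,D_2$ and permutation matrices $P_1,P_2$. Let $\mathbf{i}$ be the imaginary unit and $\omega=e^{2\pi \mathbf{i}/3}$. The matrices $S_6$ (Tao's matrix, considered up to equivalence) and $D_6$ (Diţă's matrix, considered up to equivalence) are $$S_6=\begin{bmatrix}1&1&1&1&1&1\\1&1&\omega&\omega&\omega^2&\omega^2\\1&\omega&1&\omega^2&\omega&\omega^2\\1&\omega&\omega^2&1&\omega^2&\omega\\1&\omega^2&\omega&\omega^2&1&\omega\\1&\omega^2&\omega^2&\omega&\omega&1\end{bmatrix},\qquad D_6=\begin{bmatrix}1&1&1&1&1&1\\1&-1&\mathbf{i}&-\mathbf{i}&-\mathbf{i}&\mathbf{i}\\1&\mathbf{i}&-1&\mathbf{i}&-\mathbf{i}&-\mathbf{i}\\1&-\mathbf{i}&\mathbf{i}&-1&\mathbf{i}&-\mathbf{i}\\1&-\mathbf{i}&-\mathbf{i}&\mathbf{i}&-1&\mathbf{i}\\1&\mathbf{i}&-\mathbf{i}&-\mathbf{i}&\mathbf{i}&-1\end{bmatrix}.$$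 *)

(* Defs.v *)
From HB Require Import structures.
From mathcomp Require Import all_boot all_order all_algebra.
From mathcomp Require Export complex.
From mathcomp Require Import reals trigo.

Set Implicit Arguments.
Unset Strict Implicit.
Unset Printing Implicit Defensive.

Import Order.TTheory GRing.Theory Num.Theory.

Local Open Scope ring_scope.
Local Open Scope sesquilinear_scope.
Local Open Scope complex_scope.

Definition complex_hadamard (C : numClosedFieldType) (n : nat) (H : 'M[C]_n) :=
  (forall i j, `|H i j| = 1) /\ H *m H ^t* = n%:R%:M.

Definition dephased (C : numClosedFieldType) (n : nat) (H : 'M[C]_n.+1) :=
  forall k, H ord0 k = 1 /\ H k ord0 = 1.

Definition unitary_diag_mx (C : numClosedFieldType) (n : nat) (D : 'M[C]_n) :=
  is_diag_mx D /\ D \is unitarymx.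

Definition hadamard_equiv (C : numClosedFieldType) (n : nat)
    (H1 H2 : 'M[C]_n) :=
  exists D1 P1 P2 D2 : 'M[C]_n,
    [/\ unitary_diag_mx D1, unitary_diag_mx D2,
        is_perm_mx P1, is_perm_mx P2
      & H1 = D1 *m P1 *m H2 *m P2 *m D2].

Definition mx_of_rows (A : nzRingType) (n : nat) (rows : seq (seq A)) :
  'M[A]_n := \matrix_(i, j) nth 0 (nth [::] rows i) j.

(* e^(2 pi i / 3), written out by Euler's formula *)
Definition omega (R : realType) : R[i] :=
  cos (2 * pi / 3) +i* sin (2 * pi / 3).

Definition tao_mx (R : realType) : 'M[R[i]]_6 :=
  let w := omega R in
  mx_of_rows 6
    [:: [:: 1; 1;      1;      1;      1;      1     ];
        [:: 1; 1;      w;      w;      w ^+ 2; w ^+ 2];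
        [:: 1; w;      1;      w ^+ 2; w;      w ^+ 2];
        [:: 1; w;      w ^+ 2; 1;      w ^+ 2; w     ];
        [:: 1; w ^+ 2; w;      w ^+ 2; 1;      w     ];
        [:: 1; w ^+ 2; w ^+ 2; w;      w;      1     ]].

Definition dita_mx (R : realType) : 'M[R[i]]_6 :=
  let I : R[i] := 'i in
  mx_of_rows 6
    [:: [:: 1;  1;   1;   1;   1;   1 ];
        [:: 1; -1;   I; - I; - I;   I ];
        [:: 1;  I;  -1;   I; - I; - I ];
        [:: 1; - I;  I;  -1;   I; - I ];
        [:: 1; - I; - I;  I;  -1;   I ];
        [:: 1;  I; - I; - I;   I;  -1 ]].

(* Main.v *)
Require Import Defs.
From mathcomp Require Import all_boot all_order all_algebra all_fingroup.
From mathcomp Require Import reals trigo ring lra.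

(** If some diagonal entry is -1, say at [i], then row [i] consists of pairs of
    opposite numbers, and the parallelogram law applied to another row [a] and
    its partner [a'] in row [i] leaves two options: both have diagonal entry -1
    and [H i a ^+ 2 = -1], or the diagonal entries differ, [H i a] is minus that
    of [a], and [H a a' ^+ 2 = -1].  The second one, applied again at the partner
    with diagonal entry -1, contradicts itself; so the off-diagonal entries of
    the core are i and -i.

    If the diagonal is constantly 1, put [x_ij = |1 - H i j|^2 / 4].  Rows of the
    5x5 core have [x]-sum 3, and Jacobi's identity for the complementary minors on
    [{0, i, j, k}] and [{l, m}] reads [x_ij x_ik x_jk = 9/4 x_lm (1 - x_lm)].  The
    triangle [ijk] has sum [3/2 + x_lm], so AM-GM confines every [x_lm] to
    [x <= 0.07] or [x >= 3/4]; the former is impossible, hence all [x] are 3/4 and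
    the entries are primitive cube roots of unity.

    In both cases the core has two off-diagonal values, each occurring twice in
    every row; as every 2-regular graph on five vertices is a pentagon, this
    determines [H] up to a simultaneous permutation of rows and columns. *)

Set Implicit Arguments.
Unset Strict Implicit.
Unset Printing Implicit Defensive.

Import Order.TTheory GRing.Theory Num.Theory.

Local Open Scope ring_scope.
Local Open Scope sesquilinear_scope.

(** * Two-regular graphs on five vertices *)

Fixpoint bitseqs (n : nat) : seq bitseq :=
  if n is m.+1 then [seq b :: v | b <- [:: true; false], v <- bitseqs m]
  else [:: [::]].

Lemma mem_bitseqs n (v : bitseq) : size v = n -> v \in bitseqs n.
Proof.
elim: n v => [|n IHn] [|b v] // [sv].
by apply: (allpairs_f cons); [case: b | exact: IHn].
Qed.

(* Bit [t] of [v] is the adjacency of the [t]-th pair in the lexicographic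
   order 01, 02, 03, 04, 12, 13, 14, 23, 24, 34. *)
Definition bit_adj (v : bitseq) (i j : nat) : bool :=
  let m := minn i j in
  nth false v (maxn i j - m.+1 + nth 0 [:: 0; 4; 7; 9] m)%N.

Definition pentagon (i j : nat) : bool :=
  ((j == i.+1 %% 5) || (i == j.+1 %% 5))%N.

(** Decided by running through all 1024 graphs, keeping the 2-regular ones and searching the
    relabellings [t] of each. *)
Lemma bit_adj_pentagon :
  all (fun v : bitseq =>
    has (fun t => all (fun i => all (fun j =>
        (i != j) ==> (bit_adj v i j == pentagon (nth 0 t i) (nth 0 t j)))
      (iota 0 5)) (iota 0 5)) (permutations (iota 0 5)))%N
  [seq v <- bitseqs 10 |
    all (fun i => count (fun j => (i != j) && bit_adj v i j) (iota 0 5) == 2%N)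
      (iota 0 5)].
Proof. by vm_compute. Qed.

Definition two_regular (e : rel 'I_5) :=
  symmetric e /\ forall i, #|[pred j | (i != j) && e i j]| = 2%N.

Lemma two_regular_pentagon (e : rel 'I_5) : two_regular e ->
  exists s : {perm 'I_5},
    forall i j, i != j -> e i j = pentagon (s i) (s j).
Proof.
move=> [e_sym e_deg].
pose o k : 'I_5 := inord k.
pose v := [:: e (o 0) (o 1); e (o 0) (o 2); e (o 0) (o 3); e (o 0) (o 4);
  e (o 1) (o 2); e (o 1) (o 3); e (o 1) (o 4); e (o 2) (o 3); e (o 2) (o 4);
  e (o 3) (o 4)]%N.
have eE (i j : 'I_5) : i != j -> e i j = bit_adj v i j.
  rewrite -(inord_val i) -(inord_val j) !inordK ?ltn_ord //.
  case: i j => [[|[|[|[|[|//]]]]] ?] [[|[|[|[|[|//]]]]] ?] //=;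
  by rewrite ?eqxx // e_sym.
have v_deg : v \in [seq v <- bitseqs 10 |
    all (fun i => count (fun j => (i != j) && bit_adj v i j) (iota 0 5) == 2%N)
      (iota 0 5)].
  rewrite mem_filter mem_bitseqs // andbT.
  apply/allP => i; rewrite mem_iota => /andP[_ lti].
  apply/eqP/(etrans _ (e_deg (Ordinal lti))).
  rewrite -val_enum_ord count_map cardE size_filter -enumT.
  apply: eq_count => j; rewrite !inE /=.
  rewrite -[i in LHS]/(val (Ordinal lti)) val_eqE.
  by case: eqVneq => //= ij; rewrite eE.
have /allP/(_ v v_deg)/hasP[t] := bit_adj_pentagon.
rewrite mem_permutations => t_perm /allP t_ok.
have t_size : size t = 5%N by rewrite (perm_size t_perm) size_iota.
have t_lt i : (i < 5 -> nth 0 t i < 5)%N.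
  move=> lti; have := mem_nth 0%N (_ : i < size t)%N.
  by rewrite (perm_mem t_perm) mem_iota t_size; apply.
pose f (i : 'I_5) := Ordinal (t_lt i (ltn_ord i)).
have f_inj : injective f.
  move=> i j /(congr1 val)/eqP; rewrite nth_uniq ?t_size ?ltn_ord //.
    by move/eqP/val_inj.
  by rewrite (perm_uniq t_perm) iota_uniq.
exists (perm f_inj) => i j ij; rewrite !permE eE //.
have in5 (k : 'I_5) : (k : nat) \in iota 0 5 by rewrite mem_iota ltn_ord.
by have /allP/(_ j (in5 j))/implyP/(_ ij)/eqP := t_ok i (in5 i).
Qed.

Lemma two_regular_iso (e1 e2 : rel 'I_5) : two_regular e1 -> two_regular e2 ->
  exists s : {perm 'I_5}, forall i j, i != j -> e1 i j = e2 (s i) (s j).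
Proof.
move=> /two_regular_pentagon[s1 e1E] /two_regular_pentagon[s2 e2E].
exists (s1 * s2^-1)%g => i j ij.
by rewrite e1E // e2E ?(inj_eq perm_inj) // !permM !permKV.
Qed.

(** * Matrices with two off-diagonal values in the core *)

Lemma perm_hadamard_equiv (C : numClosedFieldType) n (s : {perm 'I_n})
  (H T : 'M[C]_n) : (forall i j, H i j = T (s i) (s j)) -> hadamard_equiv H T.
Proof.
move=> HT; exists 1%:M, (perm_mx s), (perm_mx s^-1), 1%:M.
have D1 : unitary_diag_mx (1%:M : 'M[C]_n).
  split; first exact: scalar_mx_is_diag.
  by apply/unitarymxP; rewrite mul1mx trmx1 map_mx1.
split=> //; try exact: perm_mx_is_perm.
rewrite mul1mx mulmx1 -row_permE -[RHS]col_permE.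
by apply/matrixP => i j; rewrite !mxE HT.
Qed.

(** What [H] shares with its model matrix; the vanishing row sums fix how often [a] and [b]
    occur. *)
Record two_valued (C : numClosedFieldType) (d a b : C) (H : 'M[C]_6) : Prop := {
  two_valued_dephased : dephased H;
  two_valued_sym : H = H^T;
  two_valued_sum (i : 'I_5) : \sum_k H (lift ord0 i) k = 0;
  two_valued_diag (i : 'I_5) : H (lift ord0 i) (lift ord0 i) = d;
  two_valued_off (i j : 'I_5) : i != j ->
    H (lift ord0 i) (lift ord0 j) = a \/ H (lift ord0 i) (lift ord0 j) = b
}.

(** If [a] occurs [n] times off the diagonal of a core row, that row of [H] has sum
    [1 + d + 4 * b + n * (a - b)]; comparison with the relation on [d], [a], [b] gives
    [(a - b) * (n - 2) = 0]. *)
Lemma two_valued_two_regular (C : numClosedFieldType) (d a b : C) (H : 'M[C]_6) :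
  a != b -> 1 + d + 2 * a + 2 * b = 0 -> two_valued d a b H ->
  two_regular (fun i j => H (lift ord0 i) (lift ord0 j) == a).
Proof.
move=> ab dab [H1 Hsym Hsum Hd Hoff]; split=> [i j /=|i].
  by rewrite [in LHS]Hsym mxE.
set e := (X in #|X|).
have := Hsum i.
rewrite big_ord_recl (H1 _).2 (bigD1 i) //= Hd.
have off j : j != i -> H (lift ord0 i) (lift ord0 j) = b + (a - b) *+ e j.
  rewrite eq_sym /e /= => ij; rewrite ij /=.
  case: eqVneq => [->|Ha]; first by rewrite mulr1n addrC subrK.
  by case: (Hoff _ _ ij) Ha => ->; rewrite ?eqxx // addr0.
rewrite (eq_bigr _ off) big_split /= sumr_const.
rewrite cardC1 card_ord sumrMnr.
have -> : (\sum_(j | j != i) e j = #|e|)%N.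
  rewrite -sum1_card big_mkcond [RHS]big_mkcond /=; apply: eq_bigr => j _.
  by rewrite /e !inE eq_sym; case: eqP => //=; case: eqP.
move=> sum0.
have : (a - b) * (#|e|%:R - 2) = 0.
  have -> : (a - b) * (#|e|%:R - 2) =
     1 + (d + (b *+ 5.-1 + (a - b) *+ #|e|)) - (1 + d + 2 * a + 2 * b).
    by rewrite -[(a - b) *+ _]mulr_natr /=; ring.
  by rewrite sum0 dab subrr.
move/eqP; rewrite mulf_eq0 subr_eq0 (negbTE ab) /= subr_eq0 eqr_nat.
by move/eqP.
Qed.

(** The positions of [a] form isomorphic graphs in [H] and [T]; extended by fixing [ord0], the
    isomorphism matches all entries. *)
Lemma two_valued_equiv (C : numClosedFieldType) (d a b : C) (H T : 'M[C]_6) :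
  a != b -> 1 + d + 2 * a + 2 * b = 0 ->
  two_valued d a b H -> two_valued d a b T -> hadamard_equiv H T.
Proof.
move=> ab dab HH HT.
have [s sE] := two_regular_iso (two_valued_two_regular ab dab HH)
                               (two_valued_two_regular ab dab HT).
case: HH HT => [H1 _ _ Hd Hoff] [T1 _ _ Td Toff].
apply: (@perm_hadamard_equiv _ _ (lift_perm ord0 ord0 s)) => i j.
case: (unliftP ord0 i) => [i'|] ->; last by rewrite lift_perm_id (H1 _).1 (T1 _).1.
case: (unliftP ord0 j) => [j'|] ->; last by rewrite lift_perm_id (H1 _).2 (T1 _).2.
rewrite !lift_perm_lift; have [->|ij] := eqVneq i' j'; first by rewrite Hd Td.
have sij : s i' != s j' by rewrite (inj_eq perm_inj).
have := sE _ _ ij => /=.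
case: (Hoff _ _ ij) (Toff _ _ sij) => -> [] -> //.
  by rewrite eqxx eq_sym (negbTE ab).
by rewrite eqxx eq_sym (negbTE ab).
Qed.

(** * Unimodular numbers *)

(** Allows rows to be summed along any listing of the indices, in place of relabelling [H]. *)
Lemma sum_ord6 (V : nmodType) (F : 'I_6 -> V) i0 i1 i2 i3 i4 i5 :
  uniq [:: i0; i1; i2; i3; i4; i5] ->
  \sum_k F k = F i0 + (F i1 + (F i2 + (F i3 + (F i4 + F i5)))).
Proof.
move=> us; set s := (X in uniq X) in us.
have sub_s : {subset s <= index_enum 'I_6} by move=> j _; rewrite mem_index_enum.
have size_s : (size (index_enum 'I_6) <= size s)%N.
  by rewrite [index_enum _]unlock -enumT size_enum_ord.
have /(perm_big s) -> : perm_eq (index_enum 'I_6) s.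
  rewrite uniq_perm ?index_enum_uniq // => k.
  by rewrite (uniq_min_size us sub_s size_s).2.
by rewrite /s !big_cons big_nil /= addr0.
Qed.

Section Unimodular.
Variable C : numClosedFieldType.
Implicit Types u v w z c d e f : C.

Lemma unimodular_mulC u : `|u| = 1 -> u * u^* = 1.
Proof. by move=> u1; rewrite -normCK u1 expr1n. Qed.

Lemma unimodular_neq0 u : `|u| = 1 -> u != 0.
Proof. by move=> u1; rewrite -normr_eq0 u1 oner_neq0. Qed.

Lemma unimodular_conjE u : `|u| = 1 -> u^* = u^-1.
Proof.
move=> u1; apply: (mulfI (unimodular_neq0 u1)).
by rewrite unimodular_mulC // divff ?unimodular_neq0.
Qed.

(* Conjugation turns [u + v + w + z = 0] into the vanishing of the third
   elementary symmetric function, so the quartic with these roots is even. *)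
Lemma unimodular_sum4 u v w z : `|u| = 1 -> `|v| = 1 -> `|w| = 1 -> `|z| = 1 ->
  u + v + w + z = 0 -> [\/ v = - u, w = - u | z = - u].
Proof.
move=> u1 v1 w1 z1 s0.
have := congr1 (fun x => x^*) s0.
rewrite /= rmorph0 !rmorphD /= !unimodular_conjE // => t0.
have : (u + v) * (u + w) * (u + z) = 0.
  have -> : (u + v) * (u + w) * (u + z) =
    u ^+ 2 * (u + v + w + z) + u * v * w * z * (u^-1 + v^-1 + w^-1 + z^-1).
    by field; rewrite !unimodular_neq0.
  by rewrite s0 t0 !mulr0 addr0.
move/eqP; rewrite !mulf_eq0 -!orbA !addr_eq0 => /or3P[] /eqP ->; rewrite opprK.
- by constructor 1.
- by constructor 2.
- by constructor 3.
Qed.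

(* The parallelogram law for [e] and [f], whose sum and difference are
   prescribed by orthogonality to the first two rows. *)
Lemma parallelogram_relation u v c d e f :
  `|u| = 1 -> `|v| = 1 -> `|c| = 1 -> `|e| = 1 -> `|f| = 1 -> d = 1 \/ d = - 1 ->
  1 + u + d + c + e + f = 0 ->
  1 - u + (d - c) * u^* + (e - f) * v^* = 0 ->
  d * (2 + 2 * (u + u^-1) - (u ^+ 2 + u^-1 ^+ 2)) +
  c * (1 + u^-1 ^+ 2) + c^-1 * (1 + u ^+ 2) = - 4.
Proof.
move=> u1 v1 c1 e1 f1 d1 s0 t0.
have dR : d^* = d by case: d1 => ->; rewrite ?rmorphN rmorph1.
have eD : e + f = - (1 + u + d + c) by rewrite -[LHS]addr0 -[in LHS]oppr0 -s0; ring.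
have eB : e - f = - v * (1 - u + (d - c) * u^-1).
  rewrite !unimodular_conjE // in t0; apply/eqP; rewrite -subr_eq0; apply/eqP.
  by rewrite -[RHS](mulr0 v) -t0; field; rewrite !unimodular_neq0.
have : (e + f) * (e + f)^* + (e - f) * (e - f)^* = 4.
  have -> : 4 = 2 * (e * e^*) + 2 * (f * f^*) by rewrite !unimodular_mulC //; ring.
  by rewrite rmorphB rmorphD /=; ring.
rewrite eB eD !(rmorphM, rmorphN, rmorphD, rmorphB, rmorph1, fmorphV) /= dR.
rewrite !unimodular_conjE //.
move/eqP; rewrite -subr_eq0 => /eqP P.
apply/eqP; rewrite -subr_eq0 opprK -[X in _ == X]P; apply/eqP.
by case: d1 => ->; field; rewrite !unimodular_neq0.
Qed.

(** The second equation is the first for [- u] and [d']. Their difference yields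
    [4 * d * (u + u^-1) = 0] if [d' = d], and [- 2 * d * (u - u^-1) ^+ 2 = 0] if [d' = - d]. *)
Lemma parallelogram_pair u c d d' :
  `|u| = 1 -> `|c| = 1 -> d = 1 \/ d = - 1 -> d' = 1 \/ d' = - 1 ->
  d * (2 + 2 * (u + u^-1) - (u ^+ 2 + u^-1 ^+ 2)) +
  c * (1 + u^-1 ^+ 2) + c^-1 * (1 + u ^+ 2) = - 4 ->
  d' * (2 - 2 * (u + u^-1) - (u ^+ 2 + u^-1 ^+ 2)) +
  c * (1 + u^-1 ^+ 2) + c^-1 * (1 + u ^+ 2) = - 4 ->
  [/\ d = - 1, d' = - 1 & u ^+ 2 = - 1] \/
  [/\ d' = - d, u = - d & c ^+ 2 = - 1].
Proof.
move=> u1 c1 d1 d1' P Q.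
have u0 := unimodular_neq0 u1; have c0 := unimodular_neq0 c1.
have [dd|dd] : d' = d \/ d' = - d.
  by case: d1 d1' => -> [] ->; rewrite ?opprK; auto.
- left; rewrite {}dd {d' d1'} in Q *.
  have d0 : d != 0 by case: d1 => ->; rewrite ?oppr_eq0 oner_neq0.
  have u2 : u ^+ 2 = - 1.
    apply/eqP; rewrite -addr_eq0; apply/eqP.
    have := subrr (-4 : C); rewrite -{1}P -{1}Q => /eqP.
    rewrite (_ : _ - _ = 4 * (d / u) * (u ^+ 2 + 1)); last by field; rewrite u0 c0.
    by rewrite !mulf_eq0 pnatr_eq0 invr_eq0 (negbTE d0) (negbTE u0) /= => /eqP.
  have uV : u^-1 ^+ 2 = - 1 by rewrite exprVn u2 invrN1.
  have -> // : d = - 1.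
  case: d1 P => // ->; rewrite uV u2.
  have uI : u^-1 = - u.
    by apply: (mulfI u0); rewrite divff // mulrN -expr2 u2 opprK.
  rewrite uI => /eqP; rewrite -subr_eq0 => /eqP.
  rewrite (_ : _ - _ = 8); last by ring.
  by move/eqP; rewrite pnatr_eq0.
right; rewrite {}dd {d' d1'} in Q *.
have d0 : d != 0 by case: d1 => ->; rewrite ?oppr_eq0 oner_neq0.
have d2 : d * d = 1 by case: d1 => ->; rewrite ?mulrNN mulr1.
have u2 : u ^+ 2 = 1.
  have := subrr (-4 : C); rewrite -{1}P -{1}Q => /eqP.
  rewrite (_ : _ - _ = - 2 * d * (u - u^-1) ^+ 2); last by field; rewrite u0 c0.
  rewrite !mulf_eq0 oppr_eq0 pnatr_eq0 (negbTE d0) orbb subr_eq0 /= => /eqP uV.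
  by rewrite expr2 {2}uV divff.
have uI : u^-1 = u by apply: (mulfI u0); rewrite divff // -expr2 u2.
move: P; rewrite uI u2 => /eqP; rewrite -subr_eq0 => /eqP P.
have {}P : 2 * (d * u) + c + c^-1 + 2 = 0.
  apply: (@mulfI _ 2); first by rewrite pnatr_eq0.
  apply/eqP; rewrite -subr_eq0 -[X in _ == X]P; apply/eqP; ring.
have [uE|uE] : u = d \/ u = - d.
  have : (u - d) * (u + d) == 0.
    by rewrite (_ : (u - d) * (u + d) = u ^+ 2 - d * d);
      [rewrite u2 d2 subrr | ring].
  by rewrite mulf_eq0 subr_eq0 addr_eq0 => /orP[] /eqP; auto.
(* Here [c + c^-1 = - 4], although its modulus is at most 2. *)
- rewrite uE d2 in P.
  have : `|c + c^-1| = 4.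
    rewrite (_ : c + c^-1 = - 4) ?normrN ?normr_nat //.
    by apply/eqP; rewrite -subr_eq0 -[X in _ == X]P; apply/eqP; ring.
  move=> c4; have := ler_normD c c^-1.
  by rewrite c4 normfV c1 invr1 -[1 + 1]/(2%:R) ler_nat.
split=> //; rewrite uE mulrN d2 in P.
have : c * (c + c^-1) = 0.
  rewrite (_ : c + c^-1 = 0) ?mulr0 //.
  by apply/eqP; rewrite -subr_eq0 -[X in _ == X]P; apply/eqP; ring.
by rewrite mulrDr divff // -expr2 => /eqP; rewrite addr_eq0 => /eqP.
Qed.

End Unimodular.

(** * A negative diagonal entry *)

Lemma uniq_completion (T : finType) (s : seq T) : uniq s ->
  exists2 t, uniq (s ++ t) & size (s ++ t) = #|T|.
Proof.
move=> us; exists [seq x <- enum T | x \notin s].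
  rewrite cat_uniq us filter_uniq ?enum_uniq // andbT.
  by apply/hasPn => x; rewrite mem_filter => /andP[].
rewrite cardE -(count_predC (mem s) (enum T)) size_cat size_filter; congr (_ + _)%N.
rewrite -size_filter; apply/perm_size/uniq_perm => //.
  by rewrite filter_uniq ?enum_uniq.
by move=> x; rewrite mem_filter mem_enum andbT.
Qed.

Ltac reorder_uniq us :=
  move: us; rewrite /= !inE !negb_or -!andbA; repeat (case/andP => ?); move=> *;
  repeat (apply/andP; split); by rewrite // eq_sym.

Section SymmetricHadamard.
Variables (C : numClosedFieldType) (H : 'M[C]_6).
Hypotheses (hH : complex_hadamard H) (hdeph : dephased H) (hsym : H = H^T).
Hypothesis hdiag : forall i, H i i \is Num.real.

Lemma sym_entry i j : H i j = H j i. Proof. by rewrite {1}hsym mxE. Qed.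

Lemma hadamard_rows i j : \sum_k H i k * (H j k)^* = 6 *+ (i == j).
Proof.
have := congr1 (fun M : 'M_6 => M i j) hH.2; rewrite !mxE => <-.
by apply: eq_bigr => k _; rewrite !mxE.
Qed.

Lemma dephased_row_sum i : i != ord0 -> \sum_k H i k = 0.
Proof.
move=> i0; have := hadamard_rows i ord0; rewrite (negbTE i0) mulr0n => e.
by rewrite -[RHS]e; apply: eq_bigr => k _; rewrite (hdeph k).1 rmorph1 mulr1.
Qed.

Lemma real_diag i : H i i = 1 \/ H i i = - 1.
Proof.
have := unimodular_mulC (hH.1 i i); rewrite (CrealP (hdiag i)) => d2.
have : (H i i - 1) * (H i i + 1) = 0.
  have -> : (H i i - 1) * (H i i + 1) = H i i * H i i - 1 by ring.
  by rewrite d2 subrr.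
by move/eqP; rewrite mulf_eq0 subr_eq0 addr_eq0 => /orP[] /eqP; auto.
Qed.

(** The entries [1] and [- 1] cancel, so the other four sum to zero and [unimodular_sum4] pairs them
    off. *)
Lemma negative_row_pairs i a : H i i = - 1 -> uniq [:: ord0; i; a] ->
  exists a' b b', [/\ uniq [:: ord0; i; a; a'; b; b'],
    H i a' = - H i a & H i b' = - H i b].
Proof.
move=> Hi /uniq_completion[[|x [|y [|z [|//]]]]]; rewrite ?card_ord //=.
rewrite -/(uniq _) => us _.
have i0 : i != ord0 by move: us; rewrite /= !inE !negb_or eq_sym => /andP[/andP[]].
have := dephased_row_sum i0; rewrite (sum_ord6 _ us) Hi (hdeph i).2 addrA subrr.
rewrite add0r !addrA => s0.
have [Hx|Hy|Hz] := unimodular_sum4 (hH.1 i a) (hH.1 i x) (hH.1 i y) (hH.1 i z) s0.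
- exists x, y, z; split=> //; move: s0; rewrite Hx subrr add0r addrC.
  by move/eqP; rewrite addr_eq0 => /eqP.
- exists y, x, z; split=> //; first by reorder_uniq us.
  move: s0; rewrite Hy (addrAC (H i a)) subrr add0r addrC.
  by move/eqP; rewrite addr_eq0 => /eqP.
exists z, x, y; split=> //; first by reorder_uniq us.
move: s0; rewrite Hz.
rewrite (_ : _ + _ = H i y + H i x); last by ring.
by move/eqP; rewrite addr_eq0 => /eqP.
Qed.

Lemma negative_row_entry i a : H i i = - 1 -> uniq [:: ord0; i; a] ->
  (H a a = - 1 /\ H i a ^+ 2 = - 1) \/
  exists a', [/\ uniq [:: ord0; a'; a], H a' a' = - H a a,
    H i a = - H a a & H a a' ^+ 2 = - 1].
Proof.
move=> Hi ua; have [a' [b [b' [us Ha' Hb']]]] := negative_row_pairs Hi ua.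
have ua' : uniq [:: ord0; a'; a] by reorder_uniq us.
(* Along [us], row [i] reads [1, -1, u, -u, v, -v] with [u = H i a] and [v = H i b]; row [k] is
   orthogonal to rows [ord0] and [i]. *)
have row_rel k : k != ord0 -> i != k ->
  [/\ 1 + (H i k + (H k a + (H k a' + (H k b + H k b')))) = 0 &
   1 - H i k + (H k a - H k a') * (H i a)^* + (H k b - H k b') * (H i b)^* = 0].
  move=> k0 ik; split.
    by rewrite -[RHS](dephased_row_sum k0) (sum_ord6 _ us) (hdeph k).2 (sym_entry i).
  have := hadamard_rows k i; rewrite eq_sym (negbTE ik) mulr0n => <-.
  rewrite (sum_ord6 _ us) !(hdeph _).2 Hi Ha' Hb' (sym_entry i k).
  rewrite !rmorphN rmorph1 /= rmorph1; ring.
have [a0 ia] : a != ord0 /\ i != a.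
  move: ua; rewrite /= !inE !negb_or !andbT [ord0 == a]eq_sym.
  by case/andP=> /andP[_ ->] ->.
have [a'0 ia'] : a' != ord0 /\ i != a'.
  move: us; rewrite /= !inE !negb_or [ord0 == a']eq_sym -!andbA.
  by repeat (case/andP => ?); split.
have [Sa Oa] := row_rel a a0 ia; have [Sa' Oa'] := row_rel a' a'0 ia'.
rewrite !addrA in Sa; rewrite Ha' !addrA in Sa' Oa'.
have P := parallelogram_relation (hH.1 i a) (hH.1 i b) (hH.1 a a') (hH.1 a b)
  (hH.1 a b') (real_diag a) Sa Oa.
(* For row [a'] the sign of [u] changes and [H a' a'] takes the place of [H a a]. *)
have := @parallelogram_relation _ (- H i a) (H i b) (H a a') (H a' a')
  (H a' b) (H a' b') _ (hH.1 i b) (hH.1 a a') (hH.1 a' b) (hH.1 a' b')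
  (real_diag a').
rewrite normrN !rmorphN /= invrN !sqrrN => /(_ (hH.1 i a)) Q.
have {Q}Q := Q _ _.
have [] := parallelogram_pair (hH.1 i a) (hH.1 a a')
  (real_diag a) (real_diag a') P _.
- rewrite -[RHS]Q; first by ring.
    by rewrite -[RHS]Sa' (sym_entry a a'); ring.
  by rewrite -[RHS]Oa' (sym_entry a a'); ring.
- by case=> *; left.
by case=> ? ? ?; right; exists a'.
Qed.

Lemma negative_diag i0 (I : C) : I ^+ 2 = - 1 -> H i0 i0 = - 1 ->
  two_valued (- 1) I (- I) H.
Proof.
move=> I2 Hi0.
have uniq3 (i a : 'I_6) : i != ord0 -> a != ord0 -> i != a -> uniq [:: ord0; i; a].
  by move=> i_0 a_0 ia; rewrite /= !inE !negb_or ![ord0 == _]eq_sym i_0 a_0 ia.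
have N1 : (1 : C) != - 1 by rewrite -addr_eq0 -[1 + 1]/(2%:R) pnatr_eq0.
have diag i : i != ord0 -> H i i = - 1.
  move=> i_0; have [<- //|i0i] := eqVneq i0 i.
  have i0_0 : i0 != ord0.
    by apply: contraNneq N1 => i0E; rewrite -Hi0 i0E (hdeph _).1.
  case: (real_diag i) => // Hi.
  have [[Hi' _]|[a' [ua' Ha' _ sq]]] :=
    negative_row_entry Hi0 (uniq3 _ _ i0_0 i_0 i0i).
    by rewrite Hi' in Hi; rewrite Hi eqxx in N1.
  rewrite Hi in Ha'.
  (* In row [a'] the entry at [i] would have to be [- H i i = - 1], but [sq] says that its square is
     [- 1]. *)
  have [[Hi' _]|[b [_ _ Ha'i _]]] := negative_row_entry Ha' ua'.
    by rewrite Hi' in Hi; rewrite Hi eqxx in N1.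
  move: sq; rewrite sym_entry Ha'i Hi sqrrN expr1n => e.
  by rewrite -e eqxx in N1.
split=> // [i|i|i j ij].
- by rewrite dephased_row_sum // eq_sym neq_lift.
- by rewrite diag // eq_sym neq_lift.
have l0 (k : 'I_5) : lift ord0 k != ord0 by rewrite eq_sym neq_lift.
have u3 := uniq3 _ _ (l0 i) (l0 j) _.
have [|[_ sq]|[a' [ua' Ha' _ _]]] := negative_row_entry (diag _ (l0 i)) (u3 _).
- by rewrite (inj_eq lift_inj).
- have : (H (lift ord0 i) (lift ord0 j) - I) *
           (H (lift ord0 i) (lift ord0 j) + I) = 0.
    by rewrite -subr_sqr sq I2 subrr.
  by move/eqP; rewrite mulf_eq0 subr_eq0 addr_eq0 => /orP[] /eqP; auto.
have a'0 : a' != ord0.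
  by move: ua'; rewrite /= !inE !negb_or eq_sym => /andP[/andP[]].
by move: Ha'; rewrite !diag // opprK => e; rewrite e eqxx in N1.
Qed.

End SymmetricHadamard.

(** * Complementary minors *)

(* Jacobi's complementary minors, in modulus: multiply [M] by
   [block_mx A^* 0 B^* 1], where [A] and [B] are the upper blocks of [M]. *)
Lemma complementary_minors (C : numClosedFieldType) m n (c : C)
    (M : 'M[C]_(m + n)) :
  M *m M ^t* = c%:M ->
  c ^+ (m + n) * `|\det (ulsubmx M)| ^+ 2 =
  `|c ^+ m| ^+ 2 * `|\det (drsubmx M)| ^+ 2.
Proof.
move=> MM; pose A := ulsubmx M; pose B := ursubmx M.
have detM : \det M * (\det M)^* = c ^+ (m + n).
  by rewrite -det_scalar -MM det_mulmx det_map_mx det_tr.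
rewrite -detM -normCK -!exprMn -normrM; congr (_ ^+ 2).
have e : M *m block_mx (A ^t*) 0 (B ^t*) 1%:M =
    block_mx c%:M B 0 (drsubmx M).
  move: MM; rewrite -[M]submxK tr_block_mx map_block_mx mulmx_block.
  rewrite scalar_mx_block => /eq_block_mx[e1 _ e3 _].
  rewrite mulmx_block e1 e3 !mulmx0 !mulmx1 !add0r.
  by rewrite block_mxKdr.
have := congr1 (fun X => `|\det X|) e.
rewrite det_mulmx det_lblock det_ublock !det_scalar expr1n mulr1 det_map_mx det_tr.
by rewrite !normrM norm_conjC.
Qed.

Lemma det_mx22 (A : comRingType) (M : 'M[A]_2) :
  \det M = M ord0 ord0 * M ord_max ord_max - M ord0 ord_max * M ord_max ord0.
Proof.
rewrite (expand_det_row _ ord0) !big_ord_recl big_ord0 /cofactor !det_mx11 !mxE /=.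
rewrite !expr0 !expr1 addr0 !mul1r mulN1r mulrN.
by congr (_ * M _ _ - M _ _ * M _ _); apply/val_inj.
Qed.

(** Subtracting the first row leaves a symmetric 3x3 block with zero diagonal and entries [x - 1],
    [y - 1], [z - 1], whose determinant is twice their product. *)
Lemma det_bordered4 (A : comRingType) (x y z : A) (M : 'M[A]_4) :
  (forall k l, M k l = nth 0 (nth [::]
    [:: [:: 1; 1; 1; 1]; [:: 1; 1; x; y]; [:: 1; x; 1; z]; [:: 1; y; z; 1]] k) l) ->
  \det M = 2 * (x - 1) * (y - 1) * (z - 1).
Proof.
move=> ME.
rewrite (expand_det_row _ ord0) !big_ord_recl big_ord0 /cofactor.
rewrite !(expand_det_row _ ord0) !big_ord_recl !big_ord0 /cofactor !det_mx22.
rewrite !mxE !ME /=.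
ring.
Qed.

Section PositiveDiagonal.
Variables (C : numClosedFieldType) (H : 'M[C]_6).
Hypotheses (hH : complex_hadamard H) (hdeph : dephased H) (hsym : H = H^T).
Hypothesis hdiag1 : forall i, H i i = 1.

(** Complementary minors of [H] listed along [s], with [m = 4], [n = 2], [c = 6]; the factor is
    [6 ^+ 8 / (6 ^+ 6 * 2 ^+ 2) = 9]. *)
Lemma positive_diag_minors i j k l m : uniq [:: ord0; i; j; k; l; m] ->
  `|1 - H i j| ^+ 2 * `|1 - H i k| ^+ 2 * `|1 - H j k| ^+ 2 =
  9 * `|1 - H l m ^+ 2| ^+ 2.
Proof.
move=> us; set s := (X in uniq X) in us.
pose M : 'M[C]_(4 + 2) := \matrix_(a, b) H (nth ord0 s a) (nth ord0 s b).
have MM : M *m M ^t* = 6%:M.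
  apply/matrixP => a b; rewrite !mxE.
  have -> : (a == b) = (nth ord0 s a == nth ord0 s b).
    by rewrite nth_uniq ?ltn_ord // -val_eqE.
  rewrite -(hadamard_rows hH) [RHS](sum_ord6 _ us) !big_ord_recl big_ord0 addr0.
  by rewrite !mxE. 
have := complementary_minors MM.
rewrite (@det_bordered4 _ (H i j) (H i k) (H j k)); last first.
  by case=> [[|[|[|[|//]]]] ?] [[|[|[|[|//]]]] ?]; rewrite !mxE /=
    ?hdiag1 ?(hdeph _).1 ?(hdeph _).2 // (sym_entry hsym).
rewrite det_mx22 !mxE /= !hdiag1 mulr1 (sym_entry hsym m l) -expr2 => e.
have six : (6 : C) ^+ 6 != 0 by rewrite expf_eq0 pnatr_eq0.
apply: (mulfI six).
transitivity (6 ^+ (4 + 2) *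
   `|2 * (H i j - 1) * (H i k - 1) * (H j k - 1)| ^+ 2 / 4).
  by rewrite !normrM !(distrC _ 1) normr_nat !exprMn; field.
by rewrite e normrX normr_nat; field.
Qed.

End PositiveDiagonal.

Local Open Scope complex_scope.

(** * The matrices of Tao and Dita *)

Lemma omega_root (R : realType) : (omega R) ^+ 2 + omega R + 1 = 0.
Proof.
have pi0 := pi_gt0 R.
pose t : R := pi / 3.
have -> : omega R = (cos t ^+ 2 - sin t ^+ 2) +i* ((cos t * sin t) *+ 2).
  have tE : 2 * pi / 3 = t *+ 2 :> R by rewrite /t; field.
  rewrite -sin_mulr2n /omega tE; congr (_ +i* _); rewrite cos_mulr2n cos2sin2; ring.
have sin_t : sin t != 0 by rewrite gt_eqF // sin_gt0_pi // /t; lra.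
(* Divide [sin (t *+ 2) = sin (pi - t) = sin t] by [sin t]. *)
have cos_t : cos t = 1 / 2.
  have : sin (t *+ 2) = sin t.
    have -> : t *+ 2 = - t + pi by rewrite /t; field.
    by rewrite sinDpi sinN opprK.
  rewrite sin_mulr2n => e; apply: (mulIf sin_t); lra.
have sin2_t : sin t ^+ 2 = 3 / 4 by rewrite sin2cos2 cos_t; field.
rewrite cos_t sin2_t; apply/eqP; rewrite eq_complex /=.
apply/andP; split; apply/eqP; nra.
Qed.

Lemma tao_two_valued (R : realType) :
  two_valued 1 (omega R) (omega R ^+ 2) (tao_mx R).
Proof.
have w := omega_root R.
split.
- by case=> [[|[|[|[|[|[|//]]]]]] ?]; rewrite !mxE.
- apply/matrixP => -[[|[|[|[|[|[|//]]]]]] ?] [[|[|[|[|[|[|//]]]]]] ?];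
  by rewrite !mxE.
- move=> i; rewrite !big_ord_recl big_ord0 !mxE /=.
  transitivity (2 * (omega R ^+ 2 + omega R + 1)); last by rewrite w mulr0.
  by case: i => [[|[|[|[|[|//]]]]] ?] /=; ring.
- by case=> [[|[|[|[|[|//]]]]] ?]; rewrite !mxE.
- by case=> [[|[|[|[|[|//]]]]] ?] [[|[|[|[|[|//]]]]] ?]; rewrite !mxE //=; auto.
Qed.

Lemma dita_two_valued (R : realType) :
  two_valued (- 1) 'i (- 'i) (dita_mx R).
Proof.
split.
- by case=> [[|[|[|[|[|[|//]]]]]] ?]; rewrite !mxE.
- apply/matrixP => -[[|[|[|[|[|[|//]]]]]] ?] [[|[|[|[|[|[|//]]]]]] ?];
  by rewrite !mxE.
- move=> i; rewrite !big_ord_recl big_ord0 !mxE /=.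
  by case: i => [[|[|[|[|[|//]]]]] ?] /=; ring.
- by case=> [[|[|[|[|[|//]]]]] ?]; rewrite !mxE.
- by case=> [[|[|[|[|[|//]]]]] ?] [[|[|[|[|[|//]]]]] ?]; rewrite !mxE //=; auto.
Qed.

(** * A positive diagonal *)

(** The difference is three times the sum of the terms [a * (b - c) ^+ 2] plus half the sum of the
    terms [(a + b + c) * (b - c) ^+ 2]. *)
Lemma amgm3 (R : realFieldType) (a b c : R) : 0 <= a -> 0 <= b -> 0 <= c ->
  27 * (a * b * c) <= (a + b + c) ^+ 3.
Proof.
move=> a0 b0 c0; rewrite -subr_ge0.
have ha := mulr_ge0 a0 (sqr_ge0 (b - c)).
have hb := mulr_ge0 b0 (sqr_ge0 (a - c)).
have hc := mulr_ge0 c0 (sqr_ge0 (a - b)).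
have ka := mulr_ge0 (addr_ge0 (addr_ge0 a0 b0) c0) (sqr_ge0 (b - c)).
have kb := mulr_ge0 (addr_ge0 (addr_ge0 a0 b0) c0) (sqr_ge0 (a - c)).
have kc := mulr_ge0 (addr_ge0 (addr_ge0 a0 b0) c0) (sqr_ge0 (a - b)).
lra.
Qed.

(* By AM-GM, [(4 * x - 3) * (2 * x ^+ 2 + 132 * x - 9) >= 0]. *)
Lemma complementary_triangle_bound (R : realFieldType) (a b c x : R) :
  0 <= a -> 0 <= b -> 0 <= c -> a + b + c = 3 / 2 + x ->
  a * b * c = 9 / 4 * (x * (1 - x)) -> x <= 7 / 100 \/ 3 / 4 <= x.
Proof.
move=> a0 b0 c0 abc_sum abc_prod.
have := amgm3 a0 b0 c0; rewrite abc_sum abc_prod => h.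
have [|x_gt] := lerP x (7 / 100); [by left | right].
have [//|x_lt] := lerP (3 / 4) x.
(* The positive root of this quadratic is about 0.068, just below [7 / 100]. *)
have q_gt0 : 0 < 2 * x ^+ 2 + 132 * x - 9 by nra.
have : 0 < (3 - 4 * x) * (2 * x ^+ 2 + 132 * x - 9) by apply: mulr_gt0 => //; lra.
lra.
Qed.

Section PositiveDiagonalReal.
Variables (R : realType) (H : 'M[R[i]]_6).
Hypotheses (hH : complex_hadamard H) (hdeph : dephased H) (hsym : H = H^T).
Hypothesis hdiag1 : forall i, H i i = 1.

(* The squared half-distance from [H i j] to [1]. *)
Let x i j : R := (1 - complex.Re (H i j)) / 2.

Let xC i j : x i j = x j i. Proof. by rewrite /x (sym_entry hsym). Qed.

Let ReIm2 i j : complex.Re (H i j) ^+ 2 + complex.Im (H i j) ^+ 2 = 1.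
Proof. by apply: complexI; rewrite add_Re2_Im2 hH.1 expr1n. Qed.

Let x_ge0 i j : 0 <= x i j.
Proof. have := ReIm2 i j; rewrite /x => ?; nra. Qed.

Let x_le1 i j : x i j <= 1.
Proof. have := ReIm2 i j; rewrite /x => ?; nra. Qed.

(** Real part of the vanishing row sum, to which [H i ord0] and [H i i] contribute 2. *)
Let x_row i j k l m : uniq [:: ord0; i; j; k; l; m] ->
  x i j + x i k + x i l + x i m = 3.
Proof.
move=> us; have i0 : i != ord0.
  by move: us; rewrite /= !inE !negb_or eq_sym => /andP[/andP[]].
have := congr1 (@complex.Re R) (dephased_row_sum hH hdeph i0).
rewrite (sum_ord6 _ us) (hdeph i).2 hdiag1 /x.
by case: (H i j) (H i k) (H i l) (H i m) => [? ?] [? ?] [? ?] [? ?] /= ?; lra.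
Qed.

(** A unimodular [h] with real part [1 - 2 * x] has [|1 - h|^2 = 4 * x] and
    [|1 - h^2|^2 = 16 * x * (1 - x)]. *)
Let x_minor i j k l m : uniq [:: ord0; i; j; k; l; m] ->
  x i j * x i k * x j k = 9 / 4 * (x l m * (1 - x l m)).
Proof.
move=> us; have := positive_diag_minors hH hdeph hsym hdiag1 us.
have n1 a b : `|1 - H a b| ^+ 2 = (4 * x a b)%:C.
  rewrite -add_Re2_Im2; congr (_%:C); have := ReIm2 a b; rewrite /x.
  by case: (H a b) => ? ? /= ?; lra.
have n2 : `|1 - H l m ^+ 2| ^+ 2 = (16 * (x l m * (1 - x l m)))%:C.
  rewrite -add_Re2_Im2; congr (_%:C); have := ReIm2 l m; rewrite /x.
  by case: (H l m) => c d /= cd; have -> : d * d = 1 - c ^+ 2; nra.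
rewrite !n1 n2 -[9 in RHS](rmorph_nat (real_complex R)) -!rmorphM => /complexI e.
lra.
Qed.

Let x_dichotomy i j k l m : uniq [:: ord0; i; j; k; l; m] ->
  x l m <= 7 / 100 \/ 3 / 4 <= x l m.
Proof.
move=> us; have us_i : uniq [:: ord0; j; i; k; l; m] by reorder_uniq us.
have us_k : uniq [:: ord0; k; i; j; l; m] by reorder_uniq us.
have us_l : uniq [:: ord0; l; i; j; k; m] by reorder_uniq us.
have us_m : uniq [:: ord0; m; i; j; k; l] by reorder_uniq us.
apply: complementary_triangle_bound (x_minor us) => //.
(* Rows [i], [j], [k] minus rows [l], [m] give [2 * (x i j + x i k + x j k) - 2 * x l m = 3]. *)
have := x_row us; have := x_row us_i; have := x_row us_k; have := x_row us_l.
have := x_row us_m; rewrite (xC j i) (xC k i) (xC k j) !(xC l) !(xC m).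
lra.
Qed.
(* If [x i j] were small, so would be some [x k l] disjoint from it (the
   triangle [k l m] has sum [3 / 2 + x i j]), and then [x k m + x l m] would
   be both close to [2] and at most [3 / 2 + x i j]. *)
Let x_large i j k l m : uniq [:: ord0; i; j; k; l; m] -> 3 / 4 <= x i j.
Proof.
move=> us.
have us' : uniq [:: ord0; k; l; m; i; j] by reorder_uniq us.
have [x_small|//] := x_dichotomy us'.
have x_kl : x k l <= 7 / 100 \/ 3 / 4 <= x k l.
  by apply: (@x_dichotomy i j m); reorder_uniq us.
have x_km : x k m <= 7 / 100 \/ 3 / 4 <= x k m.
  by apply: (@x_dichotomy i j l); reorder_uniq us.
have x_lm := x_dichotomy us.
have us_j : uniq [:: ord0; j; i; k; l; m] by reorder_uniq us.
have us_k : uniq [:: ord0; k; i; j; l; m] by reorder_uniq us.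
have us_l : uniq [:: ord0; l; i; j; k; m] by reorder_uniq us.
have us_m : uniq [:: ord0; m; i; j; k; l] by reorder_uniq us.
have := x_row us; have := x_row us_j; have := x_row us_k; have := x_row us_l.
have := x_row us_m; rewrite (xC j i) (xC k i) (xC k j) !(xC l) !(xC m).
have := (x_le1 i k, x_le1 i l, x_le1 i m, x_le1 j k, x_le1 j l, x_le1 j m).
move=> [[[[[? ?] ?] ?] ?] ?] ? ? ? ? ?.
by case: x_kl => ?; case: x_km => ?; case: x_lm => ?; lra.
Qed.

(** Four numbers that are at least [3 / 4] and sum to [3] all equal [3 / 4]. *)
Let x_eq i j : uniq [:: ord0; i; j] -> x i j = 3 / 4.
Proof.
move=> /uniq_completion[[|k [|l [|m [|//]]]]]; rewrite ?card_ord //=.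
rewrite -/(uniq [:: ord0; i; j; k; l; m]) => us _.
have x_ij := x_large us.
have x_ik : 3 / 4 <= x i k by apply: (@x_large i k j l m); reorder_uniq us.
have x_il : 3 / 4 <= x i l by apply: (@x_large i l j k m); reorder_uniq us.
have x_im : 3 / 4 <= x i m by apply: (@x_large i m j k l); reorder_uniq us.
have := x_row us; lra.
Qed.

Lemma positive_diag_two_valued : two_valued 1 (omega R) (omega R ^+ 2) H.
Proof.
have l0 (k : 'I_5) : lift ord0 k != ord0 by rewrite eq_sym neq_lift.
split=> // [i|i j ij]; first by rewrite dephased_row_sum.
set c := H _ _.
(* The value [3 / 4] means real part [- 1 / 2], so the squared imaginary part is [3 / 4]. *)
have c_root : c ^+ 2 + c + 1 = 0.
  have : x (lift ord0 i) (lift ord0 j) = 3 / 4.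
    apply: x_eq; rewrite !cons_uniq !inE !negb_or ![ord0 == _]eq_sym !l0.
    by rewrite (inj_eq lift_inj) ij.
  have := ReIm2 (lift ord0 i) (lift ord0 j); rewrite /x -/c.
  case: c => a b /= ab a_eq; have {a_eq} aE : a = - (1 / 2) by lra.
  by apply/eqP; rewrite eq_complex /= aE; apply/andP; split; apply/eqP; nra.
have : (c - omega R) * (c - omega R ^+ 2) = 0.
  have -> : (c - omega R) * (c - omega R ^+ 2) = (c ^+ 2 + c + 1) +
    (omega R ^+ 2 + omega R + 1) * (omega R - 1 - c) by ring.
  by rewrite c_root omega_root mul0r addr0.
by move/eqP; rewrite mulf_eq0 !subr_eq0 => /orP[] /eqP; auto.
Qed.

End PositiveDiagonalReal.

(** * The two signs of the diagonal combined *)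

Lemma omega_neq_sqr (R : realType) : omega R != omega R ^+ 2.
Proof.
apply/eqP => w2; have := omega_root R; rewrite -w2 => w_eq.
(* The discriminant identity of [X^2 + X + 1]; if [omega R] equalled its square, [2 * omega R + 1]
   would vanish too. *)
have : 3 = 4 * (omega R ^+ 2 + omega R + 1) -
   (omega R + omega R + 1) * (omega R + omega R + 1) by ring.
by rewrite w_eq omega_root mulr0 mul0r subrr => /eqP; rewrite pnatr_eq0.
Qed.

Theorem theorem2p2 (R : realType) (H : 'M[R[i]]_6)
    (hH : complex_hadamard H)
    (hdeph : dephased H)
    (hsym : H = H^T)
    (hdiag : forall i, H i i \is Num.real) :
  hadamard_equiv H (tao_mx R) \/ hadamard_equiv H (dita_mx R).
Proof.
have [/existsP[i0 /eqP Hi0]|/existsPn pos] := boolP [exists i, H i i == - 1].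
  right; apply: (@two_valued_equiv _ (- 1) 'i (- 'i)).
  - rewrite -addr_eq0; apply/eqP => i0_eq.
    have := sqr_i R; have -> : 'i = 0 :> R[i].
      by apply: (@mulfI _ 2); rewrite ?pnatr_eq0 // mulr0 mulr_natl mulr2n.
    by move/eqP; rewrite expr0n eq_sym oppr_eq0 oner_eq0.
  - ring.
  - by apply: (negative_diag hH hdeph hsym hdiag _ Hi0); exact: sqr_i.
  - exact: dita_two_valued.
left; apply: (@two_valued_equiv _ 1 (omega R) (omega R ^+ 2)).
- exact: omega_neq_sqr.
- rewrite (_ : _ + _ = 2 * (omega R ^+ 2 + omega R + 1)); last by ring.
  by rewrite omega_root mulr0.
- apply: positive_diag_two_valued => // i.
  by case: (real_diag hH hdiag i) (pos i) => // ->; rewrite eqxx.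
- exact: tao_two_valued.
Qed.
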